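(* Let $G=(V,E)$ be a simple undirected graph that is minimally $k$-$st$-edge-connected, and let $\{c_e\ge 0 : e\in E\}$ be non-negative edge costs. Then $c(G)\le \sqrt{2k}\cdot p_c(G)$, where $c(G)=\sum_{e\in E}c_e$ and $p_c(G)=\sum_{v\in V}\max\{c_e : e\in\delta(v)\}$.
   Context: $\delta(v)$ denotes the set of edges of $E$ incident to $v$; a maximum over the empty set is $0$. For nodes $s,t\in V$ and a positive integer $k$, $G$ is minimally $k$-$st$-edge-connected if $G$ contains $k$ pairwise edge-disjoint $st$-paths but no proper subgraph of $G$ contains $k$ pairwise edge-disjoint $st$-paths. *)

(* Defs.v *)
From HB Require Import structures.
From mathcomp Require Import all_boot all_order all_algebra.
Set Implicit Arguments.
Unset Strict Implicit.
Unset Printing Implicit Defensive.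
Import Order.TTheory GRing.Theory Num.Theory.
Local Open Scope ring_scope.

(* The vertex set is a field, not the whole of T, so that a proper subgraph
   may omit vertices as well as edges. *)
Record sgraph (T : finType) := SGraph {
  vset : {set T};
  eset : {set {set T}};
  esetP : forall f : {set T}, f \in eset -> #|f| = 2%N /\ f \subset vset
}.

Section Graphs.
Variable T : finType.
Implicit Types (G H : sgraph T) (s t v : T) (p : seq T) (k : nat).

Definition subgraph H G : bool :=
  (vset H \subset vset G) && (eset H \subset eset G).

Definition proper_subgraph H G : bool :=
  subgraph H G && ((vset H != vset G) || (eset H != eset G)).

Definition adj G : rel T := [rel x y | [set x; y] \in eset G].

(* The path visits the vertices of s :: p in this order. *)
Definition st_path G s t p : bool :=
  [&& s \in vset G, path (adj G) s p, last s p == t & uniq (s :: p)].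

Definition path_edges s p : seq {set T} :=
  pairmap (fun x y => [set x; y]) s p.

Definition has_edge_disjoint_paths G s t k : Prop :=
  exists P : 'I_k -> seq T,
    (forall i, st_path G s t (P i)) /\
    (forall i j, i != j ->
       [disjoint path_edges s (P i) & path_edges s (P j)]).

Definition minimally_st_edge_connected G s t k : Prop :=
  has_edge_disjoint_paths G s t k /\
  (forall H, proper_subgraph H G -> ~ has_edge_disjoint_paths H s t k).

Definition delta G v : {set {set T}} := [set e in eset G | v \in e].

Variable R : rcfType.
Implicit Type c : {set T} -> R.

(* Only the values of c on eset G matter. *)
Definition total_cost G c : R := \sum_(e in eset G) c e.

(* For costs that are nonnegative on eset G, the default 0 gives the maximum
   over delta G v, with value 0 when delta G v is empty. *)
Definition power_cost G c : R :=
  \sum_(v in vset G) \big[Num.max/0]_(e in delta G v) c e.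

End Graphs.

(* Main.v *)
(* Orient every edge along the k edge-disjoint paths. A directed cycle could be
   removed without losing the k paths, so by minimality the orientation is
   acyclic and the vertices can be numbered so that arcs increase; flow balance
   then shows that at most k arcs cross any given prefix of the numbering.
   Inside a vertex set U, the d_u arcs leaving u have distinct lengths, so the
   total length is at least (sum of d_u^2)/2, while it is at most k |U| by the
   prefix bound. By Cauchy-Schwarz U spans at most sqrt(2k) |U| edges. Since the
   cost of an edge is at most the smaller of the powers of its ends, decomposing
   the powers into their level sets gives the weighted inequality. *)
Require Import Defs.
From mathcomp Require Import all_boot all_order all_algebra.
From mathcomp Require Import zify lra.
Import Order.TTheory GRing.Theory Num.Theory.
Local Open Scope ring_scope.

(** * Walks, integral flows and their decomposition into paths *)

Section Walks.
Set Implicit Arguments.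
Unset Strict Implicit.
Local Open Scope nat_scope.
Variable T : finType.
Implicit Types (x y s t v : T) (p q : seq T) (a : T * T) (A B : {set T * T}).

Definition edge_of a : {set T} := [set a.1; a.2].

Definition walk_arcs x p : seq (T * T) := pairmap pair x p.

Definition arc_rel A : rel T := [rel x y | (x, y) \in A].

Definition out_deg A v : nat := \sum_(a in A) (a.1 == v).
Definition in_deg A v : nat := \sum_(a in A) (a.2 == v).

Lemma path_edgesE x p : path_edges x p = map edge_of (walk_arcs x p).
Proof. by elim: p x => //= y p IHp x; rewrite IHp. Qed.

Lemma path_arc_rel A x p :
  path (arc_rel A) x p = all (mem A) (walk_arcs x p).
Proof. by elim: p x => //= y p IHp x; rewrite IHp. Qed.

Lemma path_adj (G : sgraph T) x p :
  path (adj G) x p = all (mem (eset G)) (path_edges x p).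
Proof. by elim: p x => //= y p IHp x; rewrite IHp. Qed.

Lemma walk_arcs_uniq x p : uniq p -> uniq (walk_arcs x p).
Proof.
have h2 : unzip2 (walk_arcs x p) = p by elim: p x => //= y p IHp x; rewrite IHp.
by move=> up; apply: (@map_uniq _ _ snd); rewrite -/unzip2 h2.
Qed.

Lemma mem_walk_edges x p a z :
  a \in walk_arcs x p -> z \in edge_of a -> z \in x :: p.
Proof.
elim: p x => //= y p IHp x; rewrite inE => /orP[/eqP->|ap za].
  by rewrite !inE /= => /orP[]/eqP->; rewrite eqxx ?orbT.
by rewrite inE (IHp y) ?orbT.
Qed.

(** The start of a simple path does not recur, so no later edge contains it; hence no edge is
    traversed twice, not even in opposite directions. *)
Lemma edge_of_inj_path x p :
  uniq (x :: p) -> {in walk_arcs x p &, injective edge_of}.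
Proof.
elim: p x => //= y p IHp x /andP[xp up] a b.
have fresh d : d \in walk_arcs y p -> edge_of (x, y) <> edge_of d.
  move=> dp e; move/negP: xp; apply; suff: x \in y :: p by [].
  by apply: (mem_walk_edges dp); rewrite -e !inE eqxx.
rewrite !inE => /orP[/eqP->|ap] /orP[/eqP->|bp] // e.
- by case: (fresh b bp).
- by case: (fresh a ap).
- by apply: (IHp y up).
Qed.

Lemma walk_balance x p v :
  count (fun a => a.1 == v) (walk_arcs x p) + (last x p == v) =
  count (fun a => a.2 == v) (walk_arcs x p) + (x == v).
Proof. by elim: p x => //= y p IHp x; rewrite -addnA IHp; lia. Qed.

Lemma sum_set_uniq (I : finType) (F : pred I) (r : seq I) :
  uniq r -> \sum_(a in [set a in r]) F a = count F r.
Proof.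
move=> ur; rewrite -sum1_count [RHS]big_mkcond big_uniq //=.
by apply: eq_big => [a|a _]; [rewrite inE | case: (F a)].
Qed.

Lemma sum_setD_uniq (I : finType) (C : {set I}) (F : pred I) (r : seq I) :
    uniq r -> all (mem C) r ->
  \sum_(a in C) F a = \sum_(a in C :\: [set a in r]) F a + count F r.
Proof.
move=> ur /allP rC; rewrite (big_setID [set a in r]) /= addnC; congr (_ + _).
have -> : C :&: [set a in r] = [set a in r].
  by apply/setIidPr/subsetP => a; rewrite inE => /rC.
exact: sum_set_uniq.
Qed.

(* The arc set [A] carries an integral flow of value [k] from [s] to [t]. *)
Definition balanced A s t k : Prop :=
  forall v, out_deg A v + k * (t == v) = in_deg A v + k * (s == v).

Lemma sum_eq_mem (S : {set T}) x : \sum_(v in S) (x == v) = (x \in S).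
Proof.
have [xS|xS] := boolP (x \in S).
  rewrite (bigD1 x) //= eqxx big1 // => v /andP[_ vx].
  by rewrite eq_sym (negPf vx).
rewrite big1 // => v vS; case: eqP => // xv; by rewrite xv vS in xS.
Qed.

Lemma balanced_cut A s t k (S : {set T}) : balanced A s t k ->
  \sum_(a in A) (a.1 \in S) + k * (t \in S) =
  \sum_(a in A) (a.2 \in S) + k * (s \in S).
Proof.
move=> bal; have : \sum_(v in S) (out_deg A v + k * (t == v)) =
                   \sum_(v in S) (in_deg A v + k * (s == v)).
  by apply: eq_bigr => v _; apply: bal.
rewrite !big_split /= -!big_distrr /= !sum_eq_mem.
have swap (F : T * T -> T) :
    \sum_(v in S) \sum_(a in A) (F a == v) = \sum_(a in A) (F a \in S).
  by rewrite exchange_big; apply: eq_bigr => a _; apply: sum_eq_mem.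
by rewrite !swap.
Qed.

(** Only [p] is repetition-free, so cycles are covered too: removing an st-path lowers the flow
    value by one, removing a cycle keeps it. The additive form avoids truncated subtraction. *)
Lemma remove_walk_balance A x p v : path (arc_rel A) x p -> uniq p ->
  let B := A :\: [set a in walk_arcs x p] in
  out_deg A v + in_deg B v + (last x p == v) =
  in_deg A v + out_deg B v + (x == v).
Proof.
rewrite path_arc_rel => pA up B; have ua := walk_arcs_uniq x up.
have outE : out_deg A v = out_deg B v + _ :=
  sum_setD_uniq (fun a => a.1 == v) ua pA.
have inE : in_deg A v = in_deg B v + _ :=
  sum_setD_uniq (fun a => a.2 == v) ua pA.
by have := walk_balance x p v; rewrite outE inE /=; lia.
Qed.

(** No arc leaves the set reachable from [s]; if it missed [t], its net outflow would have to be
    [k.+1]. *)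
Lemma balanced_connect A s t k : balanced A s t k.+1 -> connect (arc_rel A) s t.
Proof.
move=> bal; apply/negPn/negP => nst.
have := balanced_cut [set v | connect (arc_rel A) s v] bal.
rewrite !inE connect0 (negPf nst) => e.
suff: \sum_(a in A) (a.1 \in [set v | connect (arc_rel A) s v]) <=
      \sum_(a in A) (a.2 \in [set v | connect (arc_rel A) s v]) by lia.
apply: leq_sum => -[u v] uvA; rewrite !inE /=.
case: (boolP (connect _ s u)) => // su.
by rewrite (connect_trans su (connect1 _)).
Qed.

(** Flow decomposition: [balanced_connect] gives a walk, shortened to a simple path; removing its
    arcs leaves a flow of value one less. *)
Lemma balanced_paths A s t k : balanced A s t k ->
  exists P : 'I_k -> seq T,
    (forall i, [&& path (arc_rel A) s (P i), last s (P i) == t & uniq (s :: P i)])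
    /\ (forall i j, i != j ->
          [disjoint walk_arcs s (P i) & walk_arcs s (P j)]).
Proof.
elim: k A => [|k IHk] A bal; first by exists (fun=> [::]); split=> [[]|[]].
have /connectP[p0 p0A] := balanced_connect bal.
case/shortenP: p0A => p pA up _ lp; have up' : uniq p by case/andP: up.
pose B := A :\: [set a in walk_arcs s p].
have balB : balanced B s t k.
  move=> v; have := remove_walk_balance v pA up'; rewrite -lp /= -/B.
  by have := bal v; rewrite !mulSn; lia.
have [Q [Qp Qd]] := IHk _ balB.
have QA i : all (mem B) (walk_arcs s (Q i)).
  by have /and3P[+ _ _] := Qp i; rewrite path_arc_rel.
have pQ i : [disjoint walk_arcs s p & walk_arcs s (Q i)].
  rewrite disjoint_sym disjoint_has; apply/hasPn => a aQ.
  by have /allP/(_ a aQ) := QA i; rewrite !inE => /andP[].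
exists (fun i => if unlift ord0 i is Some j then Q j else p); split=> [i|i j].
  case: unliftP => [j _|_]; last by rewrite pA -lp eqxx.
  have /and3P[_ -> ->] := Qp j; rewrite path_arc_rel !andbT.
  by apply: sub_all (QA j) => a /=; rewrite !inE => /andP[].
case: unliftP => [i' ->|->]; case: unliftP => [j' ->|->] //.
- by rewrite (inj_eq lift_inj) => /Qd.
- by move=> _; rewrite disjoint_sym; apply: pQ.
Qed.

(** A return path from [v] to [u] would close a directed cycle, whose removal preserves balance but
    loses the arc [(u, v)]. *)
Lemma minimal_balanced_acyclic A s t k : balanced A s t k ->
    (forall B, B \subset A -> balanced B s t k -> B = A) ->
  forall u v, (u, v) \in A -> ~~ connect (arc_rel A) v u.
Proof.
move=> bal minA u v uvA; apply/negP => /connectP[p0 p0A].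
case/shortenP: p0A => p pA up _ lp.
have cA : path (arc_rel A) u (v :: p) by apply/andP; split.
pose B := A :\: [set a in walk_arcs u (v :: p)].
have BA : B = A.
  apply: minA => [|w]; first exact: subsetDl.
  have := remove_walk_balance w cA up; rewrite /= -lp -/B.
  by have := bal w; lia.
by move: uvA; rewrite -BA !inE eqxx.
Qed.

Lemma acyclic_numbering A :
    (forall u v, (u, v) \in A -> ~~ connect (arc_rel A) v u) ->
  exists2 g : T -> nat, injective g & forall a, a \in A -> g a.1 < g a.2.
Proof.
move=> acyc; pose h v := #|[set u | connect (arc_rel A) u v]|.
have rk v : enum_rank v < #|T| by exact: ltn_ord.
(* The number [h v] of vertices reaching [v] grows strictly along arcs, since by acyclicity a head
   does not reach its tail; [enum_rank], being below [#|T|], only breaks ties. *)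
exists (fun v => h v * #|T| + enum_rank v).
  move=> u v /(congr1 (modn^~ #|T|)); rewrite !modnMDl !modn_small //.
  by move=> /val_inj/enum_rank_inj.
case=> u v uvA /=; suff huv : h u < h v.
  apply: leq_trans (leq_addr _ _); apply: leq_trans (leq_mul huv (leqnn _)).
  by rewrite mulSn addnC ltn_add2r.
apply: proper_card; apply/properP; split.
  apply/subsetP => w; rewrite !inE => /connect_trans; apply.
  exact: connect1.
by exists v; rewrite !inE ?connect0 ?acyc.
Qed.

(** Increasing arcs can leave the prefix but never enter it, so the crossing arcs number exactly its
    net outflow. *)
Lemma balanced_prefix_cut A s t k (g : T -> nat) (n : nat) : balanced A s t k ->
    (forall a, a \in A -> g a.1 < g a.2) ->
  \sum_(a in A) (g a.1 <= n < g a.2) <= k.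
Proof.
move=> bal incr; have := balanced_cut [set v | g v <= n] bal.
suff -> : \sum_(a in A) (a.1 \in [set v | g v <= n]) =
          \sum_(a in A) (g a.1 <= n < g a.2) +
          \sum_(a in A) (a.2 \in [set v | g v <= n]) by nia.
rewrite -big_split /=; apply: eq_bigr => a /incr; rewrite !inE; lia.
Qed.

End Walks.

(** * Counting the arcs inside a vertex set *)

Section ArcCount.
Set Implicit Arguments.
Unset Strict Implicit.
Local Open Scope nat_scope.
Variables (T : finType) (A : {set T * T}) (g : T -> nat) (k : nat).
Hypothesis g_inj : injective g.
Hypothesis g_incr : forall a, a \in A -> g a.1 < g a.2.
Hypothesis g_cut : forall x, \sum_(a in A) (g a.1 <= x < g a.2) <= k.
Variable U : {set T}.

Let arcs_to u : nat := \sum_(v in U) ((u, v) \in A).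

(* The inner sum over [w] is the length of the arc [(u, v)] in the numbering
   restricted to [U]; it is enough to count [w = u] and the heads [w] of the
   other arcs leaving [u]. *)
Lemma sqr_arcs_to u : u \in U ->
  arcs_to u ^ 2 <=
  2 * \sum_(v in U) \sum_(w in U) (((u, v) \in A) && (g u <= g w < g v)).
Proof.
move=> uU; pose x v : nat := (u, v) \in A.
pose L := \sum_(v in U) \sum_(w in U) x v * x w * (g w < g v).
have diag (z : T -> T) : (forall v, v \in U -> z v \in U) ->
    \sum_(v in U) \sum_(w in U) x v * (z v == w) = arcs_to u.
  move=> zU; apply: eq_bigr => v vU.
  by rewrite -big_distrr /= sum_eq_mem zU // muln1.
(* The square counts ordered pairs of heads; by the order of their numbers these split into two
   equal halves [L] and the diagonal. *)
have sqE : arcs_to u ^ 2 <= L + L + arcs_to u.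
  have Lsym : L = \sum_(v in U) \sum_(w in U) x w * x v * (g v < g w).
    by rewrite /L exchange_big.
  rewrite -mulnn big_distrlr /= {2}Lsym.
  rewrite -(diag id) // -!big_split /=; apply: leq_sum => v vU.
  rewrite -!big_split /=; apply: leq_sum => w wU.
  rewrite /x; case: (_ \in A); case: (_ \in A); rewrite ?mul0n ?mul1n //.
  by have [|| /g_inj->] := ltngtP (g w) (g v); rewrite ?eqxx.
apply: leq_trans sqE _; suff: L + arcs_to u <=
    \sum_(v in U) \sum_(w in U) (((u, v) \in A) && (g u <= g w < g v)) by lia.
rewrite -(diag (fun=> u)) // -big_split /=; apply: leq_sum => v vU.
rewrite -big_split /=; apply: leq_sum => w wU; rewrite /x.
case uvA: (_ \in A) => //=; have /= uv := g_incr uvA.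
have [<-|_] := eqVneq u w.
  rewrite leqnn uv; case uuA: (_ \in A) => //=.
  by have := g_incr uuA; rewrite ltnn.
case uwA: (_ \in A) => //=; have /= := g_incr uwA; lia.
Qed.

Lemma sum_arcs_to : \sum_(u in U) arcs_to u =
  \sum_(a in A) ((a.1 \in U) && (a.2 \in U)).
Proof.
rewrite pair_big /= big_mkcond [RHS]big_mkcond /=.
by apply: eq_bigr => -[u v] _ /=; case: (_ \in A); case: ifP.
Qed.

(** Cauchy-Schwarz against a constant vector: [2ab <= a^2 + b^2] summed over all ordered pairs. *)
Lemma sqr_sum_leq (F : T -> nat) :
  (\sum_(u in U) F u) ^ 2 <= #|U| * \sum_(u in U) F u ^ 2.
Proof.
rewrite -(leq_pmul2l (m := 2)) // -mulnn big_distrlr big_distrr /=.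
have -> : 2 * (#|U| * \sum_(u in U) F u ^ 2) =
    \sum_(u in U) \sum_(v in U) (F u ^ 2 + F v ^ 2).
  under [RHS]eq_bigr do rewrite big_split sum_nat_const /=.
  by rewrite big_split /= sum_nat_const -big_distrr /=; lia.
apply: leq_sum => u _; rewrite big_distrr; apply: leq_sum => v _.
by case: (nat_Cauchy (F u) (F v)).
Qed.

(** Exchanging sums bounds the total arc length: each [w] in [U] is spanned by at most [k] arcs.
    Squaring keeps the statement in the natural numbers. *)
Lemma sqr_arcs_within :
  (\sum_(a in A) ((a.1 \in U) && (a.2 \in U))) ^ 2 <= 2 * k * #|U| ^ 2.
Proof.
rewrite -sum_arcs_to; apply: leq_trans (sqr_sum_leq _) _.
suff: \sum_(u in U) arcs_to u ^ 2 <= 2 * (#|U| * k) by nia.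
pose L u w := \sum_(v in U) (((u, v) \in A) && (g u <= g w < g v)).
have : \sum_(u in U) arcs_to u ^ 2 <= \sum_(u in U) 2 * \sum_(w in U) L u w.
  by apply: leq_sum => u /sqr_arcs_to; rewrite exchange_big.
move=> /leq_trans; apply; rewrite -big_distrr leq_mul2l /=.
rewrite exchange_big /= -sum_nat_const; apply: leq_sum => w _.
apply: leq_trans (g_cut (g w)); rewrite pair_big /= big_mkcond [leqRHS]big_mkcond.
by apply: leq_sum => -[u v] _ /=; case: (_ \in A); case: ifP.
Qed.

End ArcCount.

(** * From vertex sets to weights *)

(** Induction on the size of the support [U] of [f]. The least positive value of [f] is subtracted
    on [U] and from the arcs inside [U]; the removed layer is a multiple of the bound for [U]. Arc
    weights can become negative, so only upper bounds on them are carried. *)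
Lemma level_set_bound (R : realFieldType) (T : finType) (A : {set T * T})
    (K : R) (f : T -> R) (w : T * T -> R) :
    (forall U : {set T},
       (\sum_(a in A) ((a.1 \in U) && (a.2 \in U)))%N%:R <= K * #|U|%:R) ->
    (forall v, 0 <= f v) ->
    (forall a, a \in A -> w a <= f a.1 /\ w a <= f a.2) ->
  \sum_(a in A) w a <= K * \sum_v f v.
Proof.
move=> AK; have [n] := ubnP #|[set v | f v != 0]|.
elim: n f w => // n IHn f w; set U := [set v | _] => cardU f0 wf.
have fU v : v \notin U -> f v = 0 by rewrite inE negbK => /eqP.
have [U0|[x0 x0U]] := set_0Vmem U.
  have fE v : f v = 0 by rewrite fU // U0 inE.
  by rewrite [X in K * X]big1 // mulr0; apply: sumr_le0 => a /wf[]; rewrite fE.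
case: (Order.TotalTheory.arg_minP f x0U) => x xU' fx; have xU : x \in U by [].
pose m := f x; pose f' v := f v - m * (v \in U)%:R.
pose w' a := w a - m * ((a.1 \in U) && (a.2 \in U))%:R.
have f'0 v : 0 <= f' v.
  rewrite /f'; have [vU|/fU->] := boolP (v \in U).
    by rewrite mulr1 subr_ge0 fx.
  by rewrite mulr0 subr0.
have w'f' a : a \in A -> w' a <= f' a.1 /\ w' a <= f' a.2.
  move=> aA; have [] := wf a aA; have := f'0 a.1; have := f'0 a.2.
  rewrite /w' /f'.
  have [|/fU->] := boolP (a.1 \in U); have [|/fU->] := boolP (a.2 \in U) => /=;
    rewrite ?mulr0 ?mulr1 ?subr0; lra.
have cardU' : (#|[set v | f' v != 0%R]| < n)%N.
  rewrite -ltnS; apply: leq_ltn_trans cardU; apply: proper_card.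
  apply/properP; split; last by exists x; rewrite // inE /f' xU mulr1 subrr eqxx.
  apply/subsetP => v; rewrite inE; apply: contraR => vU.
  by rewrite /f' fU // (negPf vU) mulr0 subr0.
have m0 : 0 <= m by apply: f0.
have := IHn f' w' cardU' f'0 w'f'; have := ler_wpM2l m0 (AK U).
rewrite !big_split /= !sumrN -!mulr_sumr -!natr_sum.
have -> : (\sum_v (v \in U))%N = #|U| by rewrite -sum1_card [RHS]big_mkcond.
lra.
Qed.

(** * Orienting the minimal graph, and the conclusion *)

Lemma minimal_orientation (T : finType) (G : sgraph T) (s t : T) (k : nat) :
    s \in vset G -> minimally_st_edge_connected G s t k ->
  exists (A : {set T * T}) (g : T -> nat),
    [/\ {in A &, injective (@edge_of T)}, eset G = @edge_of T @: A, injective g,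
        forall a, a \in A -> (g a.1 < g a.2)%N &
        forall x, (\sum_(a in A) (g a.1 <= x < g a.2) <= k)%N].
Proof.
move=> sG [[P [Pst Pd]] minG].
pose C i := [set a in walk_arcs s (P i)]; pose A := \bigcup_i C i.
have Pu i : uniq (s :: P i) by case/and4P: (Pst i).
have Pl i : last s (P i) = t by case/and4P: (Pst i) => _ _ /eqP.
have Pw i : uniq (walk_arcs s (P i)).
  by apply: walk_arcs_uniq; case/andP: (Pu i).
have Pe i j a b : a \in walk_arcs s (P i) -> b \in walk_arcs s (P j) ->
    edge_of a = edge_of b -> i = j.
  move=> ai bj ab; apply/eqP/negPn/negP => /Pd.
  rewrite !path_edgesE disjoint_has => /hasPn/(_ _ (map_f _ ai)).
  by rewrite /= ab (map_f _ bj).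
have Ainj : {in A &, injective (@edge_of T)}.
  move=> a b /bigcupP[i _ ai] /bigcupP[j _ bj] ab.
  rewrite inE in ai; rewrite inE in bj; have ij := Pe i j a b ai bj ab.
  by rewrite -ij in bj; apply: (edge_of_inj_path (Pu i)).
have Cd i j : i != j -> [disjoint C i & C j].
  move=> ij; rewrite disjoint_subset; apply/subsetP => a; rewrite !inE => ai.
  by apply: contraNN ij => aj; apply/eqP; apply: Pe ai aj _.
have degE (F : pred (T * T)) :
    (\sum_(a in A) F a = \sum_i count F (walk_arcs s (P i)))%N.
  rewrite partition_disjoint_bigcup //=; apply: eq_bigr => i _.
  exact: sum_set_uniq.
have balA : balanced A s t k.
  move=> v; rewrite /out_deg /in_deg (degE (fun a => a.1 == v)).
  rewrite (degE (fun a => a.2 == v)).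
  have mulk m : (k * m = \sum_(i < k) m)%N by rewrite sum_nat_const card_ord.
  rewrite !mulk -!big_split /=; apply: eq_bigr => i _.
  by have := walk_balance s (P i) v; rewrite Pl.
have AG a : a \in A -> edge_of a \in eset G.
  case/bigcupP => i _; rewrite inE => ai; case/and4P: (Pst i) => _ + _ _.
  by rewrite path_adj path_edgesE => /allP/(_ _ (map_f _ ai)).
(* A balanced [B] yields [k] edge-disjoint paths using only its edges, so minimality of [G] forces
   these to be all edges. [B = A] shows that the given paths cover [G]; general [B] shows that [A]
   is a minimal flow. *)
have fullB (B : {set T * T}) :
    B \subset A -> balanced B s t k -> eset G = @edge_of T @: B.
  move=> /subsetP BA balB; apply/eqP/negPn/negP => neG.
  have BG : {subset @edge_of T @: B <= eset G} by move=> f /imsetP[a /BA/AG ? ->].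
  pose H := SGraph (fun f fB => esetP (BG f fB)).
  apply: (minG H).
    rewrite /proper_subgraph /subgraph /= subxx (eq_sym _ (eset G)) neG orbT andbT.
    exact/subsetP.
  have [Q [Qp Qd]] := balanced_paths balB; exists Q.
  have QB i : all (mem B) (walk_arcs s (Q i)).
    by have /and3P[+ _ _] := Qp i; rewrite path_arc_rel.
  split=> [i|i j ij].
    have /and3P[_ Ql Qu] := Qp i; rewrite /st_path sG Ql Qu !andbT /=.
    rewrite path_adj path_edgesE all_map; apply: sub_all (QB i) => a /= aB.
    exact: imset_f.
  have := Qd i j ij; rewrite !path_edgesE !disjoint_has.
  apply: contra => /hasP[_ /mapP[a ai ->]] /mapP[b bj ab].
  have aA := BA _ (allP (QB i) _ ai); have bA := BA _ (allP (QB j) _ bj).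
  by apply/hasP; exists a => //=; rewrite (Ainj _ _ aA bA ab).
have minA (B : {set T * T}) : B \subset A -> balanced B s t k -> B = A.
  move=> BA balB; apply/eqP; rewrite eqEsubset BA; apply/subsetP => a aA.
  have := AG a aA; rewrite (fullB B) // => /imsetP[b bB].
  by move=> /(Ainj _ _ aA (subsetP BA _ bB))->.
have [g ginj gincr] := acyclic_numbering (minimal_balanced_acyclic balA minA).
exists A, g; split=> // [|x]; first exact: fullB.
exact: (balanced_prefix_cut _ balA).
Qed.

Theorem theorem2 (R : rcfType) (T : finType) (G : sgraph T) (s t : T) (k : nat)
    (c : {set T} -> R)
    (hs : s \in vset G) (ht : t \in vset G) (hk : (0 < k)%N)
    (hG : minimally_st_edge_connected G s t k)
    (hc : forall e : {set T}, e \in eset G -> 0 <= c e) :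
  total_cost G c <= Num.sqrt (2 * k%:R) * power_cost G c.
Proof.
have [A [g [Ainj EA ginj gincr gcut]]] := minimal_orientation hs hG.
pose f v := \big[Num.max/0]_(e in delta G v) c e.
(* Vertices outside [vset G] have no incident edges, so the default 0 lets the sum run over all of
   [T]. *)
have -> : power_cost G c = \sum_v f v.
  rewrite /power_cost big_mkcond; apply: eq_bigr => v _; case: ifP => // vG.
  rewrite /f big_pred0 // => e; rewrite inE; apply/negP.
  by move=> /andP[/esetP[_ /subsetP eG] /eG]; rewrite vG.
(* Here [K] is the square root of [2k], and an arc weighs the cost of its edge, at most the power
   [f] at either end. *)
rewrite /total_cost EA big_imset //=; apply: level_set_bound => [U|v|a aA].
- rewrite -ler_sqr ?nnegrE ?mulr_ge0 ?sqrtr_ge0 ?ler0n //.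
  rewrite exprMn sqr_sqrtr ?mulr_ge0 ?ler0n // -!natrX -!natrM ler_nat.
  exact: sqr_arcs_within ginj gincr gcut _.
- by rewrite /f; elim/big_ind: _ => // [x y x0 y0|e];
    [rewrite le_max x0 | rewrite inE => /andP[/hc]].
- have eG : edge_of a \in eset G by rewrite EA imset_f.
  by split; apply: le_bigmax_cond; rewrite inE eG !inE eqxx ?orbT.
Qed.
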